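(* There exist constants $C>0$ and $n_0$ such that for every odd integer $n\ge n_0$ there is a dissection $D_n$ of the unit square $[0,1]^2$ into $n$ triangles with \[ \mathcal{R}(D_n)\le \frac{8n^4}{n^{\log_2 n}\,\log_2 n}\Bigl(1+C\frac{\log n}{n}\Bigr). \] In particular $\mathcal{R}(D_n)\le n^{-\log_2 n+O(1)}$, i.e. $\log(1/\mathcal{R}(D_n))=\Omega(\log^2 n)$.
   Context: A dissection of a polygon is a finite set of nondegenerate triangles with disjoint interiors whose union is the polygon. If its triangles have areas $a_1,\dots,a_n$, the range is $\mathcal{R}(D)=\max_{i,j}|a_i-a_j|$. *)

(* Defs.v *)
From Stdlib Require Import Reals Lra List.
Open Scope R_scope.

Definition point : Type := (R * R)%type.

Record tri : Type := Tri { tA : point; tB : point; tC : point }.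

Definition det2 (T : tri) : R :=
  let '(a1, a2) := tA T in let '(b1, b2) := tB T in let '(c1, c2) := tC T in
  (b1 - a1) * (c2 - a2) - (c1 - a1) * (b2 - a2).

Definition nondegenerate (T : tri) : Prop := det2 T <> 0.

Definition area (T : tri) : R := Rabs (det2 T) / 2.

Definition is_comb (T : tri) (l1 l2 l3 : R) (p : point) : Prop :=
  l1 + l2 + l3 = 1 /\
  fst p = l1 * fst (tA T) + l2 * fst (tB T) + l3 * fst (tC T) /\
  snd p = l1 * snd (tA T) + l2 * snd (tB T) + l3 * snd (tC T).

Definition in_triangle (T : tri) (p : point) : Prop :=
  exists l1 l2 l3, 0 <= l1 /\ 0 <= l2 /\ 0 <= l3 /\ is_comb T l1 l2 l3 p.

(* interior of a nondegenerate tri *)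
Definition in_interior (T : tri) (p : point) : Prop :=
  exists l1 l2 l3, 0 < l1 /\ 0 < l2 /\ 0 < l3 /\ is_comb T l1 l2 l3 p.

Definition in_unit_square (p : point) : Prop :=
  0 <= fst p <= 1 /\ 0 <= snd p <= 1.

Definition dissection_unit_square (D : list tri) : Prop :=
  (forall T, In T D -> nondegenerate T) /\
  (forall i j T1 T2, (i < length D)%nat -> (j < length D)%nat -> i <> j ->
      nth_error D i = Some T1 -> nth_error D j = Some T2 ->
      forall p, ~ (in_interior T1 p /\ in_interior T2 p)) /\
  (forall p, in_unit_square p <-> exists T, In T D /\ in_triangle T p).

(* range R(D) = max_{i,j} |a_i - a_j| (the 0 seed is harmless as all
   entries are >= 0 and the max is attained at i = j giving 0 anyway). *)
Definition range (D : list tri) : R :=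
  fold_right Rmax 0
    (map (fun TT => Rabs (area (fst TT) - area (snd TT))) (list_prod D D)).

Definition log2 (x : R) : R := ln x / ln 2.

(* Main.v *)
(** Write [n = N + 1 + 2 c] with [N = 2 ^ m] the largest power of two at most [n - 1].
    Cut [c] vertical strips of width [2 / n] off the square, halve each of them,
    and cut one corner triangle off the remaining rectangle; what is left is a
    trapezoid to be dissected into [N] triangles.  Extend its two non-parallel
    sides to a wedge and use them as coordinate axes: the triangle cut off by the
    segment from [(a, 0)] to [(0, b)] has area [a b / 2].  Sweeping the trapezoid
    by triangles of equal area, each moving one end of this segment, means that
    [a b = 1 - e k] after [k] steps; the only freedom is which end moves.
    The segment ends parallel to its initial position iff the signed sum of the
    increments of [ln (1 - e k)] vanishes.  For the Thue-Morse sign pattern this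
    sum is an [m]-fold difference with steps [1, 2, 4, ..., 2 ^ (m - 1)], hence
    at most [2 ^ (m (m - 1) / 2)] times the [m]-th derivative, which is of order
    [(m - 1)! e ^ m] with [e] about [4 / N ^ 2].  Forcing the last two steps to
    the exact endpoints moves this error into two areas; it is
    [n ^ (- 3/2 log2 n)] up to lower order terms in the exponent. *)
Require Import Defs.
From Stdlib Require Import Reals Arith List Lra Lia.
Import ListNotations.
Open Scope R_scope.

(** * Dissections of arbitrary planar regions *)

Definition disjoint_interiors (T1 T2 : tri) : Prop :=
  forall p, ~ (in_interior T1 p /\ in_interior T2 p).

(** Regions are arbitrary predicates and disjointness is over ordered pairs, so that a dissection
    can grow by one triangle at the head of the list. *)
Definition dissects (P : point -> Prop) (D : list tri) : Prop :=
  Forall nondegenerate D /\ ForallOrdPairs disjoint_interiors D /\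
  forall p, P p <-> Exists (fun T => in_triangle T p) D.

Lemma interior_in_triangle T p : in_interior T p -> in_triangle T p.
Proof.
  intros (l1 & l2 & l3 & H1 & H2 & H3 & H).
  exists l1, l2, l3; repeat split; try apply H; lra.
Qed.

Lemma dissects_nil : dissects (fun _ => False) [].
Proof.
  split; [constructor | split; [constructor |]].
  intros p; split; [easy | intros H; inversion H].
Qed.

Lemma dissects_cons P Q T D :
  nondegenerate T ->
  (forall p, in_interior T p -> ~ P p) ->
  (forall p, Q p <-> in_triangle T p \/ P p) ->
  dissects P D -> dissects Q (T :: D).
Proof.
  intros HT Hint HQ (Hnd & Hdisj & Hcov).
  split; [now constructor | split].
  - constructor; [| exact Hdisj].
    apply Forall_forall; intros T' HT' p [Hp Hp'].
    apply (Hint p Hp), Hcov, Exists_exists.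
    exists T'; auto using interior_in_triangle.
  - intros p; rewrite HQ, Hcov, Exists_cons; tauto.
Qed.

Lemma ForallOrdPairs_nth_error {A} (R : A -> A -> Prop) l :
  ForallOrdPairs R l ->
  forall i j x y, (i < j)%nat ->
  nth_error l i = Some x -> nth_error l j = Some y -> R x y.
Proof.
  induction 1 as [| z l Hz _ IH]; intros i j x y Hij Hx Hy.
  - now destruct i.
  - destruct j as [| j]; [lia |]; destruct i as [| i]; simpl in *.
    + injection Hx as <-; rewrite Forall_forall in Hz.
      apply Hz; eapply nth_error_In; eauto.
    + apply (IH i j); auto; lia.
Qed.

Lemma dissects_unit_square D :
  dissects in_unit_square D -> dissection_unit_square D.
Proof.
  intros (Hnd & Hdisj & Hcov); split; [| split].
  - now apply Forall_forall.
  - intros i j T1 T2 _ _ Hij H1 H2 p [Hp1 Hp2].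
    destruct (Nat.lt_total i j) as [Hlt | [Heq | Hlt]]; [| easy |].
    + apply (ForallOrdPairs_nth_error _ _ Hdisj i j T1 T2 Hlt H1 H2 p); tauto.
    + apply (ForallOrdPairs_nth_error _ _ Hdisj j i T2 T1 Hlt H2 H1 p); tauto.
  - intros p; now rewrite Hcov, Exists_exists.
Qed.

Lemma range_le D B :
  0 <= B ->
  (forall T1 T2, In T1 D -> In T2 D -> Rabs (area T1 - area T2) <= B) ->
  range D <= B.
Proof.
  intros HB H; unfold range.
  assert (Hall : forall TT, In TT (list_prod D D) ->
                 Rabs (area (fst TT) - area (snd TT)) <= B).
  { intros [T1 T2] HTT; apply in_prod_iff in HTT; now apply H. }
  induction (list_prod D D) as [| TT l IH]; simpl; [exact HB |].
  apply Rmax_lub.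
  - apply Hall; now left.
  - apply IH; intros; apply Hall; now right.
Qed.

(** * Sweeping the wedge by triangles *)

(* The part of the wedge (first quadrant) between the segments
   [(1, 0)]-[(0, 1)] and [(a, 0)]-[(0, b)]. *)
Definition band (a b : R) (p : point) : Prop :=
  0 <= fst p /\ 0 <= snd p /\ a * b <= b * fst p + a * snd p /\ fst p + snd p <= 1.

(* The case [k = 0] is separate because [band 1 1] is a segment, not an empty
   region. *)
Definition fan (e tau a b : R) (k : nat) : Prop :=
  0 < a <= 1 /\ 0 < b <= 1 /\
  ((k = 0%nat /\ a = 1 /\ b = 1) \/
   exists D, dissects (band a b) D /\ length D = k /\
             Forall (fun T => Rabs (2 * area T - e) <= tau) D).

Lemma div_nonneg x y : 0 <= x -> 0 < y -> 0 <= x / y.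
Proof.
  intros Hx Hy; apply Rmult_le_pos; [exact Hx | left; now apply Rinv_0_lt_compat].
Qed.

Lemma band_step_left a a' b p :
  0 < a' < a -> a <= 1 -> 0 < b <= 1 ->
  band a' b p <-> in_triangle (Tri (a, 0) (a', 0) (0, b)) p \/ band a b p.
Proof.
  intros Ha' Ha Hb; destruct p as [x y]; unfold band, in_triangle, is_comb; simpl.
  split.
  - intros (Hx & Hy & Hlow & Hup).
    destruct (Rle_dec (a * b) (b * x + a * y)) as [H | H]; [right; tauto | left].
    assert (Hd : 0 < b * (a - a')) by nra.
    (* The height [y] forces the weight of [(0, b)]; the other two solve [l1 + l2 = 1 - y / b] and
       [l1 * a + l2 * a' = x]. *)
    exists ((b * x - a' * (b - y)) / (b * (a - a'))),
           ((a * (b - y) - b * x) / (b * (a - a'))), (y / b).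
    repeat split; try (apply div_nonneg; nra); field; lra.
  - intros [(l1 & l2 & l3 & H1 & H2 & H3 & Hs & -> & ->) | (Hx & Hy & Hlow & Hup)].
    + assert (0 <= l1 * (a - a')) by nra.
      repeat split; try nra.
      replace l3 with (1 - l1 - l2) by lra.
      assert (0 <= l1 * (a - a') * b) by nra; nra.
    + repeat split; try tauto.
      apply Rmult_le_reg_l with a; [lra |].
      assert (0 <= (a - a') * (b * x)) by (apply Rmult_le_pos; nra).
      assert (a' * (a * b) <= a' * (b * x + a * y)) by (apply Rmult_le_compat_l; lra).
      nra.
Qed.

(** The reflection exchanging the coordinates reduces this to [band_step_left]. *)
Lemma band_step_right a b b' p :
  0 < b' < b -> b <= 1 -> 0 < a <= 1 ->
  band a b' p <-> in_triangle (Tri (0, b) (0, b') (a, 0)) p \/ band a b p.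
Proof.
  intros Hb' Hb Ha; destruct p as [x y].
  pose proof (band_step_left b b' a (y, x) Hb' Hb Ha) as H.
  unfold band, in_triangle, is_comb in *; simpl in *.
  split.
  - intros Hband; destruct H as [[(l1 & l2 & l3 & Hl) | Hl] _].
    + repeat split; lra.
    + left; exists l1, l2, l3; lra.
    + right; repeat split; lra.
  - intros Hor.
    enough (0 <= y /\ 0 <= x /\ b' * a <= a * y + b' * x /\ y + x <= 1) by lra.
    apply H; destruct Hor as [(l1 & l2 & l3 & Hl) | Hl].
    + left; exists l1, l2, l3; lra.
    + right; repeat split; lra.
Qed.

(** Common core of both kinds of step; [e] and [tau] refer to doubled areas. On the first step there
    is no dissection to extend: [band 1 1] is a segment, which the penultimate hypothesis puts
    inside [T], so [T] alone suffices. *)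
Lemma fan_extend e tau a b a' b' k T :
  fan e tau a b k -> 0 < a' <= 1 -> 0 < b' <= 1 ->
  nondegenerate T ->
  (forall p, in_interior T p -> ~ band a b p) ->
  (forall p, band a' b' p <-> in_triangle T p \/ band a b p) ->
  (a = 1 -> b = 1 -> forall p, band 1 1 p -> in_triangle T p) ->
  Rabs (2 * area T - e) <= tau ->
  fan e tau a' b' (S k).
Proof.
  intros (_ & _ & HD) Ha' Hb' HT Hint Hreg Hfirst Harea.
  split; [exact Ha' | split; [exact Hb' | right]].
  destruct HD as [(-> & -> & ->) | (D & HD & Hlen & Hareas)].
  - exists [T]; split; [| split; [reflexivity |]].
    + apply (dissects_cons (fun _ => False)); auto using dissects_nil.
      intros p; rewrite Hreg; specialize (Hfirst eq_refl eq_refl p); tauto.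
    + constructor; [exact Harea | constructor].
  - exists (T :: D); split; [| simpl; auto].
    now apply (dissects_cons (band a b)).
Qed.

Lemma band_one p : band 1 1 p -> 0 <= fst p /\ 0 <= snd p /\ fst p + snd p = 1.
Proof. unfold band; lra. Qed.

Lemma fan_step_left e tau a a' b k :
  fan e tau a b k -> 0 < a' < a -> Rabs ((a - a') * b - e) <= tau ->
  fan e tau a' b (S k).
Proof.
  intros Hf Ha' Harea; pose proof Hf as (Ha & Hb & _).
  assert (Hdet : det2 (Tri (a, 0) (a', 0) (0, b)) = - ((a - a') * b))
    by (unfold det2; simpl; ring).
  assert (Hpos : 0 < (a - a') * b) by (apply Rmult_lt_0_compat; lra).
  apply (fan_extend e tau a b a' b k (Tri (a, 0) (a', 0) (0, b))); auto; try lra.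
  - unfold nondegenerate; lra.
  - intros [x y] (l1 & l2 & l3 & H1 & H2 & H3 & Hs & Hx & Hy) (_ & _ & Hlow & _).
    simpl in *; subst x y.
    (* A positive weight at [(a', 0)] puts the point strictly on the apex side of the line through
       [(a, 0)] and [(0, b)]. *)
    assert (0 < l2 * ((a - a') * b)) by (apply Rmult_lt_0_compat; lra).
    replace l3 with (1 - l1 - l2) in Hlow by lra; nra.
  - intros p; apply band_step_left; lra.
  - intros -> -> p Hp; apply band_one in Hp.
    exists (fst p), 0, (snd p); unfold is_comb; simpl; lra.
  - unfold area; rewrite Hdet, Rabs_Ropp, (Rabs_pos_eq ((a - a') * b)) by lra.
    now replace (2 * ((a - a') * b / 2)) with ((a - a') * b) by field.
Qed.

Lemma fan_step_right e tau a b b' k :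
  fan e tau a b k -> 0 < b' < b -> Rabs ((b - b') * a - e) <= tau ->
  fan e tau a b' (S k).
Proof.
  intros Hf Hb' Harea; pose proof Hf as (Ha & Hb & _).
  assert (Hdet : det2 (Tri (0, b) (0, b') (a, 0)) = (b - b') * a)
    by (unfold det2; simpl; ring).
  assert (Hpos : 0 < (b - b') * a) by (apply Rmult_lt_0_compat; lra).
  apply (fan_extend e tau a b a b' k (Tri (0, b) (0, b') (a, 0))); auto; try lra.
  - unfold nondegenerate; lra.
  - intros [x y] (l1 & l2 & l3 & H1 & H2 & H3 & Hs & Hx & Hy) (_ & _ & Hlow & _).
    simpl in *; subst x y.
    assert (0 < l2 * ((b - b') * a)) by (apply Rmult_lt_0_compat; lra).
    replace l3 with (1 - l1 - l2) in Hlow by lra; nra.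
  - intros p; apply band_step_right; lra.
  - intros -> -> p Hp; apply band_one in Hp.
    exists (snd p), 0, (fst p); unfold is_comb; simpl; lra.
  - unfold area; rewrite Hdet, (Rabs_pos_eq ((b - b') * a)) by lra.
    now replace (2 * ((b - b') * a / 2)) with ((b - b') * a) by field.
Qed.

(** * Placing the wedge in the square *)

(* Sends the wedge apex to [(s, 0)] and the segment [(1, 0)]-[(0, 1)] to the
   left side of the unit square. *)
Definition shear (s : R) (p : point) : point := (s * (1 - fst p - snd p), snd p).

Definition shear_inv (s : R) (p : point) : point := (1 - snd p - fst p / s, snd p).

Definition shear_tri (s : R) (T : tri) : tri :=
  Tri (shear s (tA T)) (shear s (tB T)) (shear s (tC T)).

Lemma is_comb_shear s T l1 l2 l3 p :
  s <> 0 ->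
  is_comb (shear_tri s T) l1 l2 l3 p <-> is_comb T l1 l2 l3 (shear_inv s p).
Proof.
  intros Hs; destruct T as [[x1 y1] [x2 y2] [x3 y3]], p as [x y].
  unfold is_comb, shear_tri, shear, shear_inv; simpl.
  split; intros (Hl & Hx & Hy); repeat split; try assumption.
  - rewrite Hx, Hy; replace l1 with (1 - l2 - l3) by lra; field; exact Hs.
  - replace x with (s * (1 - y - (1 - y - x / s))) by (field; exact Hs).
    rewrite Hx, Hy; replace l1 with (1 - l2 - l3) by lra; ring.
Qed.

Lemma det2_shear s T : det2 (shear_tri s T) = - s * det2 T.
Proof.
  destruct T as [[x1 y1] [x2 y2] [x3 y3]]; unfold det2; simpl; ring.
Qed.

Lemma in_triangle_shear s T p :
  s <> 0 -> in_triangle (shear_tri s T) p <-> in_triangle T (shear_inv s p).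
Proof.
  intros Hs; split; intros (l1 & l2 & l3 & H1 & H2 & H3 & H);
    exists l1, l2, l3; repeat (split; [assumption |]);
    apply (is_comb_shear s T l1 l2 l3 p Hs); exact H.
Qed.

Lemma in_interior_shear s T p :
  s <> 0 -> in_interior (shear_tri s T) p -> in_interior T (shear_inv s p).
Proof.
  intros Hs (l1 & l2 & l3 & H1 & H2 & H3 & H);
    exists l1, l2, l3; repeat (split; [assumption |]);
    apply (is_comb_shear s T l1 l2 l3 p Hs); exact H.
Qed.

Lemma dissects_shear s P D :
  s <> 0 -> dissects P D ->
  dissects (fun p => P (shear_inv s p)) (map (shear_tri s) D).
Proof.
  intros Hs (Hnd & Hdisj & Hcov); split; [| split].
  - apply Forall_map; revert Hnd; apply Forall_impl; intros T HT.
    unfold nondegenerate in *; rewrite det2_shear.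
    apply Rmult_integral_contrapositive; split; lra.
  - clear Hnd Hcov; induction Hdisj as [| T D HT _ IH]; simpl; constructor; auto.
    apply Forall_map; revert HT; apply Forall_impl; intros T' HT' p [H1 H2].
    apply (HT' (shear_inv s p)); split; now apply in_interior_shear.
  - intros p; rewrite Hcov, !Exists_exists; split.
    + intros (T & HT & Hp); exists (shear_tri s T).
      split; [now apply in_map | now apply in_triangle_shear].
    + intros (T' & HT' & Hp); apply in_map_iff in HT' as (T & <- & HT).
      exists T; split; [exact HT | now apply in_triangle_shear in Hp].
Qed.

Lemma area_shear s T : 0 < s -> area (shear_tri s T) = s * area T.
Proof.
  intros Hs; unfold area; rewrite det2_shear, Rabs_mult, Rabs_Ropp, (Rabs_pos_eq s); lra.
Qed.

(** * Corner triangle, strips and trapezoid *)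

Definition slab (w : R) (p : point) : Prop := 0 <= fst p <= w /\ 0 <= snd p <= 1.

(** The line through [(0, 1)] and [(w, 1 - d)] meets the base at [(w / d, 0)], which is therefore
    the wedge apex. The shear with this apex takes the cut [a = b = 1 - d] to the vertical side from
    [(w, 0)] to [(w, 1 - d)]. *)
Lemma dissects_slab_corner w d D :
  0 < w -> 0 < d < 1 ->
  dissects (fun p => band (1 - d) (1 - d) (shear_inv (w / d) p)) D ->
  dissects (slab w) (Tri (0, 1) (w, 1) (w, 1 - d) :: D).
Proof.
  intros Hw Hd.
  assert (Hband : forall x y, band (1 - d) (1 - d) (shear_inv (w / d) (x, y)) <->
            0 <= x <= w /\ 0 <= y /\ d * x <= w * (1 - y)).
  { intros x y; unfold band, shear_inv; simpl.
    assert (Hxw : exists z, x = w * z /\ x / (w / d) = d * z).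
    { exists (x / w); split; field; lra. }
    destruct Hxw as (z & -> & ->).
    split.
    - intros (H1 & H2 & H3 & H4).
      assert (0 <= z) by nra.
      assert (z <= 1).
      { assert ((1 - d) * (d * z) <= (1 - d) * d) by lra.
        apply Rmult_le_reg_l in H0; [| lra]; nra. }
      repeat split; nra.
    - intros ([H1 H2] & H3 & H4).
      assert (0 <= z) by nra. assert (z <= 1) by nra.
      assert (0 <= 1 - y - d * z) by nra.
      assert ((1 - d) * (d * z) <= (1 - d) * d) by (apply Rmult_le_compat_l; nra).
      repeat split; nra. }
  apply dissects_cons.
  - unfold nondegenerate, det2; simpl.
    replace _ with (- (w * d)) by ring; nra.
  - intros [x y] (l1 & l2 & l3 & H1 & H2 & H3 & Hs & Hx & Hy); rewrite Hband.
    simpl in *; subst x y; intros (_ & _ & H).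
    assert (0 < l2 * (d * w)) by (apply Rmult_lt_0_compat; nra).
    replace l1 with (1 - l2 - l3) in H by lra; nra.
  - intros [x y]; rewrite Hband; unfold slab, in_triangle, is_comb; simpl; split.
    + intros ([Hx0 Hxw] & Hy0 & Hy1).
      destruct (Rle_dec (d * x) (w * (1 - y))) as [H | H]; [right; tauto | left].
      exists (1 - x / w), ((d * x - w * (1 - y)) / (w * d)), ((1 - y) / d).
      repeat split; try (apply div_nonneg; nra); try (field; lra).
      replace (1 - x / w) with ((w - x) / w) by (field; lra).
      apply div_nonneg; lra.
    + intros [(l1 & l2 & l3 & H1 & H2 & H3 & Hs & -> & ->) | H].
      * replace l1 with (1 - l2 - l3) in * by lra; repeat split; nra.
      * repeat split; nra.
Qed.

Lemma dissects_slab_strip w h D :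
  0 < w -> 0 < h -> dissects (slab w) D ->
  dissects (slab (w + h))
    (Tri (w + h, 0) (w + h, 1) (w, 1) :: Tri (w, 0) (w + h, 0) (w, 1) :: D).
Proof.
  intros Hw Hh HD.
  (* The intermediate region is the old slab together with the half of the strip below the diagonal
     from [(w, 1)] to [(w + h, 0)]. *)
  apply (dissects_cons
           (fun p => 0 <= fst p /\ 0 <= snd p <= 1 /\ fst p <= w + h * (1 - snd p))).
  - unfold nondegenerate, det2; simpl; nra.
  - intros [x y] (l1 & l2 & l3 & H1 & H2 & H3 & Hs & Hx & Hy).
    simpl in *; subst x y; intros (_ & _ & H).
    replace l1 with (1 - l2 - l3) in H by lra; nra.
  - intros [x y]; unfold slab, in_triangle, is_comb; simpl; split.
    + intros ([Hx0 Hxw] & Hy0 & Hy1).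
      destruct (Rle_dec x (w + h * (1 - y))) as [H | H]; [right; tauto | left].
      exists (1 - y), ((x - w) / h - (1 - y)), ((w + h - x) / h).
      replace ((x - w) / h - (1 - y)) with ((x - w - h * (1 - y)) / h) by (field; lra).
      repeat split; try (apply div_nonneg; nra); try (field; lra); lra.
    + intros [(l1 & l2 & l3 & H1 & H2 & H3 & Hs & -> & ->) | H].
      * replace l1 with (1 - l2 - l3) in * by lra; repeat split; nra.
      * repeat split; nra.
  - revert HD; apply dissects_cons.
    + unfold nondegenerate, det2; simpl; nra.
    + intros [x y] (l1 & l2 & l3 & H1 & H2 & H3 & Hs & Hx & Hy).
      unfold slab; simpl in *; subst x y; intros (H & _).
      replace l1 with (1 - l2 - l3) in H by lra; nra.
    + intros [x y]; unfold slab, in_triangle, is_comb; simpl; split.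
      * intros (Hx0 & [Hy0 Hy1] & Hxy).
        destruct (Rle_dec x w) as [H | H]; [right; tauto | left].
        exists (1 - y - (x - w) / h), ((x - w) / h), y.
        replace (1 - y - (x - w) / h) with ((h * (1 - y) - (x - w)) / h) by (field; lra).
        repeat split; try (apply div_nonneg; nra); try (field; lra); lra.
      * intros [(l1 & l2 & l3 & H1 & H2 & H3 & Hs & -> & ->) | H].
        -- replace l1 with (1 - l2 - l3) in * by lra; repeat split; nra.
        -- repeat split; nra.
Qed.
Lemma slab_strips w h v c D :
  0 < w -> 0 < h -> v = w + INR c * h -> dissects (slab w) D ->
  exists D', dissects (slab v) D' /\ length D' = (length D + 2 * c)%nat /\
             forall T, In T D' -> In T D \/ area T = h / 2.
Proof.
  intros Hw Hh -> HD; induction c as [| c IH].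
  - exists D; split; [| split; [lia | auto]].
    now replace (w + INR 0 * h) with w by (simpl; ring).
  - destruct IH as (D' & HD' & Hlen & Harea).
    assert (0 <= INR c * h) by (apply Rmult_le_pos; [apply pos_INR | lra]).
    rewrite S_INR; replace (w + (INR c + 1) * h) with (w + INR c * h + h) by ring.
    eexists; split; [apply dissects_slab_strip; eauto; lra |].
    split; [simpl; lia |].
    intros T [<- | [<- | HT]]; [right | right | now apply Harea];
      unfold area, det2; simpl;
      match goal with |- Rabs ?z / 2 = _ => replace z with h by ring end;
      rewrite Rabs_pos_eq; lra.
Qed.

(** With [q = N + 1] and slab width [w = q / n], the corner triangle has area [w * d / 2 = 1 / n],
    as has each half strip. The shear scales areas by [w / d = q ^ 2 / (2 * n)], so doubled area
    [4 / q ^ 2] in the wedge also becomes [1 / n]; only the fan contributes an error. *)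
Lemma square_of_fan tau N c :
  let n := INR (N + 1 + 2 * c) in
  let d := 2 / INR (N + 1) in
  (2 <= N)%nat -> 0 <= tau ->
  fan (4 / INR (N + 1) ^ 2) tau (1 - d) (1 - d) N ->
  exists D, dissects in_unit_square D /\ length D = (N + 1 + 2 * c)%nat /\
    forall T, In T D -> Rabs (area T - / n) <= INR (N + 1) ^ 2 / (4 * n) * tau.
Proof.
  intros n d HN Htau (_ & _ & [(H0 & _) | (D & HD & Hlen & Harea)]); [lia |].
  set (q := INR (N + 1)) in *.
  assert (Hq : 3 <= q).
  { unfold q; replace 3 with (INR 3) by (simpl; ring); apply le_INR; lia. }
  assert (Hn : n = q + 2 * INR c).
  { unfold n, q; rewrite (plus_INR (N + 1)), mult_INR; simpl; ring. }
  pose proof (pos_INR c) as Hc.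
  assert (Hd : 0 < d < 1).
  { unfold d; split; [apply Rdiv_lt_0_compat; lra |].
    apply Rmult_lt_reg_r with q; [lra |]; field_simplify; lra. }
  set (w := q / n).
  assert (Hw : 0 < w) by (apply Rdiv_lt_0_compat; lra).
  assert (Hs : 0 < w / d) by (apply Rdiv_lt_0_compat; lra).
  assert (Hbound : 0 <= q ^ 2 / (4 * n) * tau).
  { apply Rmult_le_pos; [apply div_nonneg; nra | exact Htau]. }
  apply (dissects_shear (w / d)) in HD; [| lra].
  apply dissects_slab_corner in HD; try lra.
  apply (slab_strips w (2 / n) 1 c) in HD; auto; cycle 1.
  { apply Rdiv_lt_0_compat; lra. }
  { unfold w; rewrite Hn; field; lra. }
  destruct HD as (D' & HD' & Hlen' & Harea'); exists D'.
  split; [| split].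
  - exact HD'.
  - rewrite Hlen'; simpl; rewrite length_map; lia.
  - intros T HT; destruct (Harea' T HT) as [[<- | HT'] | ->].
    + unfold area, det2; simpl.
      match goal with |- Rabs (Rabs ?z / 2 - _) <= _ =>
        replace z with (- (2 / n)) by (unfold w, d; field; lra) end.
      rewrite Rabs_Ropp, (Rabs_pos_eq (2 / n)) by (apply div_nonneg; lra).
      replace (2 / n / 2 - / n) with 0 by (field; lra).
      now rewrite Rabs_R0.
    + apply in_map_iff in HT' as (T' & <- & HT').
      rewrite Forall_forall in Harea; specialize (Harea T' HT').
      rewrite area_shear by lra.
      replace (w / d * area T' - / n)
        with (q ^ 2 / (4 * n) * (2 * area T' - 4 / q ^ 2))
        by (unfold w, d; field; lra).
      rewrite Rabs_mult, (Rabs_pos_eq (q ^ 2 / (4 * n))) by (apply div_nonneg; nra).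
      apply Rmult_le_compat_l; [apply div_nonneg; nra | exact Harea].
    + replace (2 / n / 2 - / n) with 0 by (field; lra).
      now rewrite Rabs_R0.
Qed.

(** * Signed sums along the Thue-Morse word *)

Fixpoint thue_morse (m : nat) : list bool :=
  match m with
  | O => [true]
  | S m => thue_morse m ++ map negb (thue_morse m)
  end.

Lemma length_thue_morse m : length (thue_morse m) = (2 ^ m)%nat.
Proof.
  induction m as [| m IH]; simpl; [reflexivity |].
  rewrite length_app, length_map, IH; lia.
Qed.

(** Opposite final signs mean that the last two triangles move different ends of the segment, so
    both ends can be corrected. *)
Lemma thue_morse_last_two m :
  exists l s, thue_morse (S m) = l ++ [s; negb s].
Proof.
  induction m as [| m (l & s & IH)].
  - now exists [], true.
  - change (thue_morse (S (S m)))
      with (thue_morse (S m) ++ map negb (thue_morse (S m))).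
    exists (thue_morse (S m) ++ map negb l), (negb s).
    now rewrite IH at 2; rewrite map_app, app_assoc.
Qed.

Fixpoint signed_sum (f : R -> R) (x : R) (l : list bool) : R :=
  match l with
  | [] => 0
  | s :: l => (if s then f x else - f x) + signed_sum f (x + 1) l
  end.

Lemma signed_sum_app f l1 l2 x :
  signed_sum f x (l1 ++ l2) =
  signed_sum f x l1 + signed_sum f (x + INR (length l1)) l2.
Proof.
  revert x; induction l1 as [| s l1 IH]; intros x.
  - simpl; rewrite Rplus_0_r; ring.
  - cbn [app signed_sum length]; rewrite IH, S_INR.
    replace (x + 1 + INR (length l1)) with (x + (INR (length l1) + 1)) by ring; ring.
Qed.

Lemma signed_sum_negb f l x :
  signed_sum f x (map negb l) = - signed_sum f x l.
Proof.
  revert x; induction l as [| [] l IH]; intros x; simpl; rewrite ?IH; ring.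
Qed.

Lemma derivable_signed_sum f f' l x b :
  (forall y, x <= y <= b -> derivable_pt_lim f y (f' y)) ->
  x + INR (length l) - 1 <= b ->
  derivable_pt_lim (fun y => signed_sum f y l) x (signed_sum f' x l).
Proof.
  revert x; induction l as [| s l IH]; intros x Hf Hb; simpl.
  - apply derivable_pt_lim_const.
  - cbn [length] in Hb; rewrite S_INR in Hb.
    pose proof (pos_INR (length l)) as Hl.
    assert (Hx : derivable_pt_lim f x (f' x)) by (apply Hf; lra).
    apply (derivable_pt_lim_plus (fun y => if s then f y else - f y)
             (fun y => signed_sum f (y + 1) l)).
    + destruct s; [exact Hx | now apply derivable_pt_lim_opp].
    + replace (signed_sum f' (x + 1) l) with (signed_sum f' (x + 1) l * (1 + 0)) by ring.
      apply (derivable_pt_lim_comp (fun y => y + 1) (fun y => signed_sum f y l)).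
      * apply (derivable_pt_lim_plus id (fun _ => 1));
          [apply derivable_pt_lim_id | apply derivable_pt_lim_const].
      * apply IH; [intros y Hy; apply Hf; lra | lra].
Qed.

(** This is [2 ^ (m (m - 1) / 2)], the product of the difference steps [1, 2, ..., 2 ^ (m - 1)]. *)
Fixpoint tm_const (m : nat) : R :=
  match m with
  | O => 1
  | S m => 2 ^ m * tm_const m
  end.

Lemma tm_const_pos m : 0 < tm_const m.
Proof.
  induction m as [| m IH]; simpl; [lra |].
  apply Rmult_lt_0_compat; [apply pow_lt; lra | exact IH].
Qed.

(* Doubling the word is a difference with step [2 ^ m], which the mean value
   theorem trades for one derivative. *)
Lemma thue_morse_sum_le m (F : nat -> R -> R) x b M :
  (forall j y, (j < m)%nat -> x <= y <= b -> derivable_pt_lim (F j) y (F (S j) y)) ->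
  (forall y, x <= y <= b -> Rabs (F m y) <= M) ->
  x + 2 ^ m - 1 <= b ->
  Rabs (signed_sum (F 0%nat) x (thue_morse m)) <= tm_const m * M.
Proof.
  revert F x; induction m as [| m IH]; intros F x HF HM Hb.
  - simpl in *; rewrite Rplus_0_r, Rmult_1_l; apply HM; lra.
  - assert (Hlen : INR (length (thue_morse m)) = 2 ^ m).
    { rewrite length_thue_morse, pow_INR; reflexivity. }
    assert (H2 : 1 <= 2 ^ m) by (apply pow_R1_Rle; lra).
    assert (Hb' : x + 2 * 2 ^ m - 1 <= b) by exact Hb.
    cbn [thue_morse]; rewrite signed_sum_app, signed_sum_negb, Hlen.
    destruct (MVT_cor2 (fun y => signed_sum (F 0%nat) y (thue_morse m))
                (fun y => signed_sum (F 1%nat) y (thue_morse m)) x (x + 2 ^ m))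
      as (c & Hc & Hcx); [lra | |].
    + intros c Hc; apply derivable_signed_sum with b; [| lra].
      intros y Hy; apply HF; [lia | lra].
    + replace (signed_sum (F 0%nat) x (thue_morse m) +
               - signed_sum (F 0%nat) (x + 2 ^ m) (thue_morse m))
        with (- (signed_sum (F 1%nat) c (thue_morse m) * 2 ^ m)) by (cbv beta in Hc; lra).
      rewrite Rabs_Ropp, Rabs_mult, (Rabs_pos_eq (2 ^ m)), Rmult_comm by lra.
      cbn [tm_const]; rewrite Rmult_assoc; apply Rmult_le_compat_l; [lra |].
      (* The induction continues from the mean value point [c], with the sequence of derivatives
         shifted by one; [b] stays fixed, as [c] lies at most [2 ^ m] beyond [x]. *)
      apply (IH (fun j => F (S j))); [| | lra].
      * intros j y Hj Hy; apply HF; [lia | lra].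
      * intros y Hy; apply HM; lra.
Qed.

(** * Iterated derivatives of [ln (1 - e * x)] *)

Definition log_deriv (e : R) (j : nat) (x : R) : R :=
  match j with
  | O => ln (1 - e * x)
  | S i => - (INR (fact i) * (e / (1 - e * x)) ^ S i)
  end.

Lemma derivable_log_deriv e j x :
  0 < 1 - e * x -> derivable_pt_lim (log_deriv e j) x (log_deriv e (S j) x).
Proof.
  intros Hx.
  assert (Hlin : derivable_pt_lim (fun y => 1 - e * y) x (- e)).
  { replace (- e) with (0 - (0 * x + e * 1)) by ring.
    apply (derivable_pt_lim_minus (fun _ => 1) (fun y => e * y)).
    - apply derivable_pt_lim_const.
    - apply (derivable_pt_lim_mult (fun _ => e) id);
        [apply derivable_pt_lim_const | apply derivable_pt_lim_id]. }
  destruct j as [| i].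
  - replace (log_deriv e 1 x) with (/ (1 - e * x) * - e) by (simpl; field; lra).
    apply (derivable_pt_lim_comp (fun y => 1 - e * y) ln); [exact Hlin |].
    now apply derivable_pt_lim_ln.
  - assert (Hfrac : derivable_pt_lim (fun y => e / (1 - e * y)) x
                      ((e / (1 - e * x)) ^ 2)).
    { replace ((e / (1 - e * x)) ^ 2)
        with ((0 * (1 - e * x) - - e * e) / Rsqr (1 - e * x))
        by (unfold Rsqr; field; lra).
      apply (derivable_pt_lim_div (fun _ => e) (fun y => 1 - e * y));
        [apply derivable_pt_lim_const | exact Hlin | lra]. }
    replace (log_deriv e (S (S i)) x)
      with (- (0 * (e / (1 - e * x)) ^ S i +
               INR (fact i) * (INR (S i) * (e / (1 - e * x)) ^ pred (S i) *
                               (e / (1 - e * x)) ^ 2))).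
    2:{ unfold log_deriv; rewrite fact_simpl, mult_INR; simpl pred; simpl pow; ring. }
    apply (derivable_pt_lim_opp (fun y => INR (fact i) * (e / (1 - e * y)) ^ S i)).
    apply (derivable_pt_lim_mult (fun _ => INR (fact i)) (fun y => (e / (1 - e * y)) ^ S i)).
    + apply derivable_pt_lim_const.
    + apply (derivable_pt_lim_comp (fun y => e / (1 - e * y)) (fun z => z ^ S i));
        [exact Hfrac | apply derivable_pt_lim_pow].
Qed.

Lemma log_deriv_le e rho j x :
  0 < e -> 0 < 1 - e * x -> e / (1 - e * x) <= rho ->
  Rabs (log_deriv e (S j) x) <= INR (fact j) * rho ^ S j.
Proof.
  intros He Hx Hrho; unfold log_deriv.
  assert (0 < e / (1 - e * x)) by (apply Rdiv_lt_0_compat; lra).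
  rewrite Rabs_Ropp, Rabs_pos_eq.
  - apply Rmult_le_compat_l; [apply pos_INR |].
    apply pow_incr; lra.
  - apply Rmult_le_pos; [apply pos_INR | apply pow_le; lra].
Qed.

Definition log_step (e x : R) : R := ln (1 - e * (x + 1)) - ln (1 - e * x).

Lemma thue_morse_log_step_le e m :
  0 < e -> e * 2 ^ S m < 1 ->
  Rabs (signed_sum (log_step e) 0 (thue_morse (S m))) <=
  tm_const (S m) * (2 * (INR (fact m) * (e / (1 - e * 2 ^ S m)) ^ S m)).
Proof.
  intros He HeN.
  assert (HN : 1 <= 2 ^ S m) by (apply pow_R1_Rle; lra).
  set (N := 2 ^ S m) in *.
  assert (Hpos : forall y, y <= N -> 1 - e * N <= 1 - e * y) by (intros; nra).
  assert (Hrho : forall y, y <= N -> e / (1 - e * y) <= e / (1 - e * N)).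
  { intros y Hy; apply Rmult_le_compat_l; [lra |].
    apply Rinv_le_contravar; [lra | now apply Hpos]. }
  (* The range stops at [N - 1] because [log_step] also evaluates at [x + 1]. *)
  apply (thue_morse_sum_le (S m) (fun j x => log_deriv e j (x + 1) - log_deriv e j x)
           0 (N - 1)).
  - intros j y _ Hy.
    pose proof (Hpos y); pose proof (Hpos (y + 1)).
    apply (derivable_pt_lim_minus (fun x => log_deriv e j (x + 1)) (log_deriv e j)).
    + replace (log_deriv e (S j) (y + 1)) with (log_deriv e (S j) (y + 1) * (1 + 0)) by ring.
      apply (derivable_pt_lim_comp (fun x => x + 1) (log_deriv e j)).
      * apply (derivable_pt_lim_plus id (fun _ => 1));
          [apply derivable_pt_lim_id | apply derivable_pt_lim_const].
      * apply derivable_log_deriv; lra.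
    + apply derivable_log_deriv; lra.
  (* The two neighbouring derivatives are bounded separately, whence the factor 2. *)
  - intros y Hy; pose proof (Hpos y); pose proof (Hpos (y + 1)).
    eapply Rle_trans; [apply Rabs_triang |]; rewrite Rabs_Ropp, <- Rplus_diag.
    apply Rplus_le_compat; apply log_deriv_le; try apply Hrho; lra.
  - unfold N; lra.
Qed.

(** * Walking along the sign word and closing the fan *)

(* Both arms of the fan: [arm e x S] and [arm e x (- S)] have product [1 - e x]
   and quotient [exp S]. *)
Definition arm (e x S : R) : R := exp ((ln (1 - e * x) + S) / 2).

Lemma arm_pos e x S : 0 < arm e x S.
Proof. apply exp_pos. Qed.

Lemma arm_mul_opp e x S : 0 < 1 - e * x -> arm e x S * arm e x (- S) = 1 - e * x.
Proof.
  intros Hx; unfold arm; rewrite <- exp_plus.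
  replace ((ln (1 - e * x) + S) / 2 + (ln (1 - e * x) + - S) / 2)
    with (ln (1 - e * x)) by field.
  now apply exp_ln.
Qed.

(** Lowering [S] by the increment of the logarithm cancels that increment, so this end of the
    segment stays in place. *)
Lemma arm_step_fixed e x S : arm e (x + 1) (S - log_step e x) = arm e x S.
Proof. unfold arm, log_step; f_equal; field. Qed.

(** The product of the arms drops from [1 - e * x] to [1 - e * (x + 1)] while the other arm is
    fixed, so the doubled area is exactly [e]. *)
Lemma arm_step_moved e x S :
  0 < e -> 0 < 1 - e * (x + 1) ->
  (arm e x S - arm e (x + 1) (S + log_step e x)) * arm e x (- S) = e.
Proof.
  intros He Hx.
  rewrite Rmult_minus_distr_r, arm_mul_opp by lra.
  rewrite <- (arm_step_fixed e x (- S)).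
  replace (- S - log_step e x) with (- (S + log_step e x)) by ring.
  rewrite arm_mul_opp by exact Hx; ring.
Qed.

Lemma lt_of_diff_mul a a' b e : 0 < b -> 0 < e -> (a - a') * b = e -> a' < a.
Proof.
  intros Hb He H; destruct (Rlt_le_dec a' a) as [|Hle]; [assumption | nra].
Qed.

(** The sign [true] moves the end on the first axis and adds the increment to [S]; [false] moves the
    other end and subtracts it. Every triangle added has exact area, whatever the signs. *)
Lemma fan_walk e tau l k S :
  0 < e -> 0 <= tau -> e * (INR k + INR (length l)) < 1 ->
  fan e tau (arm e (INR k) S) (arm e (INR k) (- S)) k ->
  let S' := S + signed_sum (log_step e) (INR k) l in
  fan e tau (arm e (INR k + INR (length l)) S')
    (arm e (INR k + INR (length l)) (- S')) (k + length l).
Proof.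
  intros He Htau; revert k S; induction l as [| s l IH]; intros k S Hlt Hfan.
  - simpl; now rewrite !Rplus_0_r, Nat.add_0_r.
  - cbn [length signed_sum] in *; rewrite S_INR in *.
    pose proof (pos_INR (length l)) as Hl.
    assert (Hx : 0 < 1 - e * (INR k + 1)) by nra.
    specialize (IH (Datatypes.S k) (S + (if s then log_step e (INR k) else - log_step e (INR k)))).
    rewrite S_INR in IH; cbv zeta in *.
    replace (INR k + (INR (length l) + 1)) with (INR k + 1 + INR (length l)) in * by ring.
    rewrite <- Rplus_assoc, Nat.add_succ_r; apply IH; [exact Hlt |].
    destruct s.
    + replace (- (S + log_step e (INR k))) with (- S - log_step e (INR k)) by ring.
      rewrite arm_step_fixed.
      pose proof (arm_step_moved e (INR k) S He Hx) as Hstep.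
      apply (fan_step_left e tau (arm e (INR k) S)); [exact Hfan | split |].
      * apply arm_pos.
      * exact (lt_of_diff_mul _ _ _ _ (arm_pos _ _ _) He Hstep).
      * rewrite Hstep, Rminus_diag, Rabs_R0; exact Htau.
    + change (S + - log_step e (INR k)) with (S - log_step e (INR k)) at 1.
      rewrite arm_step_fixed.
      replace (- (S + - log_step e (INR k))) with (- S + log_step e (INR k)) by ring.
      pose proof (arm_step_moved e (INR k) (- S) He Hx) as Hstep.
      rewrite Ropp_involutive in Hstep.
      apply (fan_step_right e tau _ (arm e (INR k) (- S))); [exact Hfan | split |].
      * apply arm_pos.
      * exact (lt_of_diff_mul _ _ _ _ (arm_pos _ _ _) He Hstep).
      * rewrite Hstep, Rminus_diag, Rabs_R0; exact Htau.
Qed.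

Lemma Rabs_le_inv x y : Rabs x <= y -> - y <= x <= y.
Proof. pose proof (Rle_abs x); pose proof (Rle_abs (- x)); rewrite Rabs_Ropp in *; lra. Qed.

(** The exact steps would end at [a] and [b]; both are redirected to [t]. Because [a * b = t * t],
    the two area errors are opposite, [(a - t) * q] and [(t - a) * q], and [q <= 1]. *)
Lemma fan_close_left e tau t p q a b k :
  fan e tau p q k -> tau < e -> 0 < e -> 0 < t -> 0 < a ->
  (p - a) * q = e -> (q - b) * a = e -> a * b = t * t ->
  Rabs (a - t) <= tau -> Rabs (b - t) <= tau ->
  fan e tau t t (S (S k)).
Proof.
  intros Hfan Htau He Ht Ha Hpa Hqb Hab Hat Hbt; pose proof Hfan as (Hp & Hq & _).
  pose proof (lt_of_diff_mul p a q e (proj1 Hq) He Hpa) as Hap.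
  apply Rabs_le_inv in Hbt.
  (* An exact step has length at least [e > tau], so the redirected steps still go towards the
     apex. *)
  assert (Hpa' : e <= p - a) by nra.
  assert (Hqb' : e <= q - b) by nra.
  assert (Herr : forall z, Rabs z = Rabs ((a - t) * q) -> Rabs z <= tau).
  { intros z ->; rewrite Rabs_mult, (Rabs_pos_eq q) by lra.
    pose proof (Rabs_pos (a - t)); nra. }
  apply Rabs_le_inv in Hat.
  apply (fan_step_right e tau t q); [apply (fan_step_left e tau p); auto |  |].
  - lra.
  - apply Herr; f_equal; rewrite <- Hpa; ring.
  - lra.
  - apply Herr; rewrite <- Rabs_Ropp; f_equal; nra.
Qed.

Lemma fan_close_right e tau t p q a b k :
  fan e tau p q k -> tau < e -> 0 < e -> 0 < t -> 0 < b ->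
  (q - b) * p = e -> (p - a) * b = e -> a * b = t * t ->
  Rabs (a - t) <= tau -> Rabs (b - t) <= tau ->
  fan e tau t t (S (S k)).
Proof.
  intros Hfan Htau He Ht Hb Hqb Hpa Hab Hat Hbt; pose proof Hfan as (Hp & Hq & _).
  pose proof (lt_of_diff_mul q b p e (proj1 Hp) He Hqb) as Hbq.
  apply Rabs_le_inv in Hat.
  assert (Hqb' : e <= q - b) by nra.
  assert (Hpa' : e <= p - a) by nra.
  assert (Herr : forall z, Rabs z = Rabs ((b - t) * p) -> Rabs z <= tau).
  { intros z ->; rewrite Rabs_mult, (Rabs_pos_eq p) by lra.
    pose proof (Rabs_pos (b - t)); nra. }
  apply Rabs_le_inv in Hbt.
  apply (fan_step_left e tau p); [apply (fan_step_right e tau p q); auto |  |].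
  - lra.
  - apply Herr; f_equal; rewrite <- Hqb; ring.
  - lra.
  - apply Herr; rewrite <- Rabs_Ropp; f_equal; nra.
Qed.

Lemma Rabs_exp_sub_1_le x : Rabs x <= / 2 -> Rabs (exp x - 1) <= 2 * Rabs x.
Proof.
  intros Hx.
  pose proof (exp_ineq1_le x) as H1; pose proof (exp_ineq1_le (- x)) as H2.
  pose proof (exp_pos x) as H3.
  assert (H4 : exp x * exp (- x) = 1).
  { rewrite <- exp_plus; replace (x + - x) with 0 by ring; apply exp_0. }
  apply Rabs_le_inv in Hx; apply Rabs_le.
  assert (H5 : exp x * (1 - x) <= 1) by nra.
  destruct (Rle_dec 0 x) as [Hx0 | Hx0].
  - rewrite Rabs_pos_eq by lra; split; nra.
  - rewrite Rabs_left by lra; split; nra.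
Qed.

(** As [t] is the square root of [1 - e * x], the arm equals [t * exp (S / 2)]; the halving absorbs
    the factor 2 of [Rabs_exp_sub_1_le]. *)
Lemma arm_close e x S t tau :
  0 < t <= 1 -> t * t = 1 - e * x -> Rabs S <= tau -> tau <= 1 ->
  Rabs (arm e x S - t) <= tau.
Proof.
  intros Ht Htt HS Htau.
  assert (Harm : arm e x S - t = t * (exp (S / 2) - 1)).
  { unfold arm; rewrite <- Htt, ln_mult by lra.
    replace ((ln t + ln t + S) / 2) with (ln t + S / 2) by field.
    rewrite exp_plus, exp_ln by lra; ring. }
  assert (HS2 : Rabs (S / 2) = Rabs S / 2).
  { unfold Rdiv; rewrite Rabs_mult, (Rabs_pos_eq (/ 2)) by lra; reflexivity. }
  pose proof (Rabs_exp_sub_1_le (S / 2) ltac:(lra)) as Hexp.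
  rewrite Harm, Rabs_mult, (Rabs_pos_eq t) by lra.
  pose proof (Rabs_pos (exp (S / 2) - 1)); nra.
Qed.

Lemma fan_thue_morse e tau t m :
  0 < e -> 0 < t <= 1 -> t * t = 1 - e * 2 ^ S m ->
  Rabs (signed_sum (log_step e) 0 (thue_morse (S m))) <= tau ->
  tau <= 1 -> tau < e ->
  fan e tau t t (2 ^ S m).
Proof.
  intros He Ht Htt HS Htau1 Htau.
  assert (Htau0 : 0 <= tau) by (eapply Rle_trans; [apply Rabs_pos | exact HS]).
  destruct (thue_morse_last_two m) as (l & s & Hl).
  assert (Hlen : (2 ^ S m)%nat = S (S (length l))).
  { rewrite <- length_thue_morse, Hl, length_app; simpl; lia. }
  assert (HN : 2 ^ S m = INR (length l) + 1 + 1).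
  { rewrite <- !S_INR, <- Hlen, pow_INR; reflexivity. }
  rewrite Hl, signed_sum_app, Rplus_0_l in HS; cbn [signed_sum] in HS.
  rewrite Hlen; rewrite HN in Htt; clear Hl Hlen HN m.
  pose proof (pos_INR (length l)) as Hpos.
  assert (Hx2 : 0 < 1 - e * (INR (length l) + 1 + 1)) by nra.
  assert (Hx1 : 0 < 1 - e * (INR (length l) + 1)) by nra.
  assert (Hfan : fan e tau (arm e 0 0) (arm e 0 (- 0)) 0).
  { assert (Harm : arm e 0 0 = 1).
    { unfold arm; rewrite Rmult_0_r, Rminus_0_r, ln_1, Rplus_0_r, Rdiv_0_l; apply exp_0. }
    rewrite Ropp_0, Harm; split; [lra | split; [lra | left; auto]]. }
  (* All steps but the last two follow the exact walk. *)
  apply (fan_walk e tau l 0 0) in Hfan; [| lra | lra | simpl; nra].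
  cbv zeta in Hfan; simpl INR in Hfan; rewrite !Rplus_0_l, Nat.add_0_l in Hfan.
  set (x := INR (length l)) in *.
  set (S0 := signed_sum (log_step e) 0 l) in *.
  destruct s; simpl negb in HS; cbv iota in HS.
  (* [S1] and [S2] are the sums after the two remaining exact steps; the arms at [S2] and [- S2] are
     the ends to be corrected to [t]. *)
  - set (S1 := S0 + log_step e x) in *.
    set (S2 := S1 - log_step e (x + 1)) in *.
    assert (HS2 : S0 + (log_step e x + (- log_step e (x + 1) + 0)) = S2)
      by (unfold S2, S1; ring).
    rewrite HS2 in HS.
    assert (Ha : arm e (x + 1 + 1) S2 = arm e (x + 1) S1) by apply arm_step_fixed.
    assert (Hb : arm e (x + 1) (- S1) = arm e x (- S0)).
    { rewrite <- (arm_step_fixed e x); f_equal; unfold S1; ring. }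
    apply (fan_close_left e tau t _ _ (arm e (x + 1 + 1) S2) (arm e (x + 1 + 1) (- S2))
             _ Hfan); auto; try lra.
    + apply arm_pos.
    + rewrite Ha; apply arm_step_moved; assumption.
    + rewrite Ha, <- Hb.
      replace (- S2) with (- S1 + log_step e (x + 1)) by (unfold S2; ring).
      rewrite <- (Ropp_involutive S1) at 3; apply arm_step_moved; assumption.
    + rewrite Htt; apply arm_mul_opp; assumption.
    + apply arm_close; auto.
    + apply arm_close; auto; rewrite Rabs_Ropp; assumption.
  - set (S1 := S0 - log_step e x) in *.
    set (S2 := S1 + log_step e (x + 1)) in *.
    assert (HS2 : S0 + (- log_step e x + (log_step e (x + 1) + 0)) = S2)
      by (unfold S2, S1; ring).
    rewrite HS2 in HS.
    assert (Ha : arm e (x + 1 + 1) (- S2) = arm e (x + 1) (- S1)).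
    { rewrite <- (arm_step_fixed e (x + 1)); f_equal; unfold S2; ring. }
    assert (Hb : arm e (x + 1) S1 = arm e x S0) by apply arm_step_fixed.
    apply (fan_close_right e tau t _ _ (arm e (x + 1 + 1) S2) (arm e (x + 1 + 1) (- S2))
             _ Hfan); auto; try lra.
    + apply arm_pos.
    + rewrite Ha; replace (- S1) with (- S0 + log_step e x) by (unfold S1; ring).
      rewrite <- (Ropp_involutive S0) at 3; apply arm_step_moved; assumption.
    + rewrite Ha, <- Hb; apply arm_step_moved; assumption.
    + rewrite Htt; apply arm_mul_opp; assumption.
    + apply arm_close; auto.
    + apply arm_close; auto; rewrite Rabs_Ropp; assumption.
Qed.

(** * Growth estimates *)

Lemma mul_128_le_pow2 M : (11 <= M)%nat -> INR M * 2 ^ 7 <= 2 ^ M.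
Proof.
  intros HM; induction HM as [| M HM IH].
  - simpl; lra.
  - rewrite S_INR; change (2 ^ S M) with (2 * 2 ^ M).
    assert (1 <= INR M) by (apply (le_INR 1); lia).
    assert (0 < 2 ^ 7) by (apply pow_lt; lra); nra.
Qed.

(** From [m] to [S m] the left side grows by [2 ^ S m * (S m * 2 ^ 7)] and the right side by
    [2 ^ S m * 2 ^ S m * 2]. From [m = 10] on, the right side thus gains a factor of at least 2 per
    step. *)
Lemma tm_const_fact_growth :
  exists m0, forall m, (m0 <= m)%nat ->
    tm_const (S m) * INR (fact m) * 2 ^ (7 * S m + 2) <= 2 ^ (S m * S m).
Proof.
  set (u := fun m => tm_const (S m) * INR (fact m) * 2 ^ (7 * S m + 2)).
  assert (Hu0 : forall m, 0 < u m).
  { intros m; unfold u; apply Rmult_lt_0_compat; [apply Rmult_lt_0_compat |];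
      [apply tm_const_pos | apply INR_fact_lt_0 | apply pow_lt; lra]. }
  assert (Hstep : forall j, u (10 + j)%nat * 2 ^ j <= u 10%nat * 2 ^ (S (10 + j) * S (10 + j))).
  { induction j as [| j IH].
    - simpl pow at 1; rewrite Nat.add_0_r, Rmult_1_r.
      pose proof (Hu0 10%nat).
      assert (1 <= 2 ^ (S 10 * S 10)) by (apply pow_R1_Rle; lra); nra.
    - rewrite Nat.add_succ_r; assert (Hm : (11 <= S (10 + j))%nat) by lia.
      revert IH Hm; generalize (10 + j)%nat; intros m IH Hm.
      assert (Hu : u (S m) = u m * (2 ^ S m * (INR (S m) * 2 ^ 7))).
      { unfold u; replace (7 * S (S m) + 2)%nat with (7 * S m + 2 + 7)%nat by lia.
        rewrite pow_add, fact_simpl, mult_INR.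
        change (tm_const (S (S m))) with (2 ^ S m * tm_const (S m)); ring. }
      assert (Hsq : 2 ^ (S (S m) * S (S m)) = 2 ^ (S m * S m) * (2 ^ S m * (2 ^ S m * 2))).
      { replace (S (S m) * S (S m))%nat with (S m * S m + (S m + (S m + 1)))%nat by lia.
        rewrite !pow_add, pow_1; reflexivity. }
      assert (HM : INR (S m) * 2 ^ 7 <= 2 ^ S m) by (now apply mul_128_le_pow2).
      assert (Hp : 0 < 2 ^ S m) by (apply pow_lt; lra).
      rewrite Hu, Hsq; change (2 ^ S j) with (2 * 2 ^ j).
      replace (u m * (2 ^ S m * (INR (S m) * 2 ^ 7)) * (2 * 2 ^ j))
        with ((u m * 2 ^ j) * (2 ^ S m * (INR (S m) * 2 ^ 7 * 2))) by ring.
      rewrite <- (Rmult_assoc (u 10%nat)); apply Rmult_le_compat.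
      + apply Rmult_le_pos; [left; apply Hu0 | apply pow_le; lra].
      + pose proof (pos_INR (S m)); apply Rmult_le_pos; [lra |].
        assert (0 < 2 ^ 7) by (apply pow_lt; lra); nra.
      + exact IH.
      + apply Rmult_le_compat_l; lra. }
  (* The initial value is never computed: the gained factor [2 ^ j] eventually exceeds it. *)
  destruct (INR_unbounded (u 10%nat)) as [j0 Hj0].
  exists (10 + j0)%nat; intros m Hm.
  specialize (Hstep (m - 10)%nat); fold (u m).
  assert (Hj : (j0 <= m - 10)%nat) by lia.
  replace (10 + (m - 10))%nat with m in Hstep by lia.
  revert Hstep Hj; generalize (m - 10)%nat; intros j Hstep Hj.
  pose proof (poly j 1 ltac:(lra)) as Hpoly.
  replace (1 + 1) with 2 in Hpoly by ring.
  assert (INR j0 <= INR j) by now apply le_INR.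
  pose proof (Hu0 10%nat).
  assert (Hpow : 0 < 2 ^ (S m * S m)) by (apply pow_lt; lra).
  apply Rmult_le_reg_r with (2 ^ j); [apply pow_lt; lra |].
  eapply Rle_trans; [exact Hstep |].
  rewrite Rmult_comm; apply Rmult_le_compat_l; lra.
Qed.

(** With [L = log2 n] the power [n ^ L] is [2 ^ (L * L)], and [L <= S m]. The other factors,
    [8 * n ^ 4 / L] and [1 + ln n / n], are at least 1. *)
Lemma target_bound_ge n m :
  2 <= n <= 2 ^ S m ->
  / 2 ^ (S m * S m) <=
  8 * n ^ 4 / (Rpower n (log2 n) * log2 n) * (1 + 1 * ln n / n).
Proof.
  intros [Hn2 Hn].
  assert (Hl2 : / 2 < ln 2) by exact ln_lt_2.
  assert (Hln2 : ln 2 <= ln n).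
  { destruct Hn2 as [H | <-]; [left; apply ln_increasing; lra | lra]. }
  assert (Hln : ln n <= INR (S m) * ln 2).
  { rewrite <- ln_pow by lra.
    destruct Hn as [H | ->]; [left; apply ln_increasing; lra | lra]. }
  assert (Hlog : 0 < log2 n <= INR (S m)).
  { unfold log2; split; [apply Rdiv_lt_0_compat; lra |].
    apply Rmult_le_reg_r with (ln 2); [lra |].
    unfold Rdiv; rewrite Rmult_assoc, Rinv_l; lra. }
  assert (Hlogn : log2 n <= 2 * n).
  { unfold log2; apply Rmult_le_reg_r with (ln 2); [lra |].
    unfold Rdiv; rewrite Rmult_assoc, Rinv_l, Rmult_1_r by lra.
    pose proof (exp_ineq1_le (ln n)) as H; rewrite exp_ln in H by lra; nra. }
  assert (HP : Rpower n (log2 n) <= 2 ^ (S m * S m)).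
  { rewrite <- Rpower_pow by lra; unfold Rpower; rewrite mult_INR.
    assert (log2 n * ln n <= INR (S m) * INR (S m) * ln 2).
    { rewrite Rmult_assoc; apply Rmult_le_compat; lra. }
    destruct H as [H | ->]; [left; now apply exp_increasing | lra]. }
  assert (HP0 : 0 < Rpower n (log2 n)) by apply exp_pos.
  assert (Hfac : 1 <= 1 + 1 * ln n / n).
  { assert (0 <= 1 * ln n / n) by (apply div_nonneg; lra); lra. }
  assert (Hpoly : log2 n <= 8 * n ^ 4).
  { assert (1 <= n ^ 3) by (apply pow_R1_Rle; lra).
    replace (8 * n ^ 4) with (8 * n * n ^ 3) by ring; nra. }
  assert (Hmain : / 2 ^ (S m * S m) <= 8 * n ^ 4 / (Rpower n (log2 n) * log2 n)).
  { apply Rle_trans with (/ Rpower n (log2 n)).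
    - apply Rinv_le_contravar; assumption.
    - replace (/ Rpower n (log2 n)) with (log2 n / (Rpower n (log2 n) * log2 n))
        by (field; lra).
      apply Rmult_le_compat_r; [| exact Hpoly].
      left; apply Rinv_0_lt_compat, Rmult_lt_0_compat; lra. }
  assert (0 < / 2 ^ (S m * S m)) by (apply Rinv_0_lt_compat, pow_lt; lra).
  nra.
Qed.

(** * Choice of parameters and conclusion *)

Lemma thue_morse_square :
  exists m0, forall m c, (m0 <= m)%nat ->
  exists D, dissects in_unit_square D /\
    length D = (2 ^ S m + 1 + 2 * c)%nat /\ range D <= / 2 ^ (S (S m) * S (S m)).
Proof.
  destruct tm_const_fact_growth as [m0 Hgrowth].
  exists (m0 + 1)%nat; intros m c Hm.
  specialize (Hgrowth m ltac:(lia)).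
  set (M := S m) in *.
  set (N := 2 ^ M).
  assert (HNnat : INR (2 ^ M) = N) by (rewrite pow_INR; reflexivity).
  assert (HN : 4 <= N).
  { replace 4 with (2 ^ 2) by ring; apply Rle_pow; [lra | unfold M; lia]. }
  set (q := INR (2 ^ M + 1)).
  assert (Hq : q = N + 1) by (unfold q; rewrite plus_INR, HNnat; reflexivity).
  set (n := INR (2 ^ M + 1 + 2 * c)).
  assert (Hnq : q <= n) by (apply le_INR; lia).
  set (e := 4 / q ^ 2).
  assert (He : 0 < e) by (apply Rdiv_lt_0_compat; nra).
  set (tau := tm_const M * (2 * (INR (fact m) * (16 / N ^ 2) ^ M))).
  set (B := / 2 ^ (S M * S M)).
  assert (HB : 0 < B) by (apply Rinv_0_lt_compat, pow_lt; lra).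
  (* Since [N = 2 ^ M], the power in [tau] is [2 ^ (4 * M - 2 * M * M)]; the exponent [7 * M + 2] in
     [Hgrowth] collects [N], the 2, [2 ^ (4 * M)] and the excess [2 * M + 1] of [S M * S M] over
     [M * M]. *)
  assert (Htau : N * tau <= B).
  { assert (Hbig : 0 < 2 ^ (M * M)) by (apply pow_lt; lra).
    assert (H16 : (16 / N ^ 2) ^ M = 2 ^ (4 * M) / (2 ^ (M * M) * 2 ^ (M * M))).
    { unfold Rdiv; rewrite Rpow_mult_distr, pow_inv; f_equal.
      - rewrite pow_mult; f_equal; ring.
      - f_equal; unfold N; rewrite <- !pow_mult, <- pow_add; f_equal; lia. }
    assert (HB' : B = / (2 ^ (M * M) * 2 ^ (2 * M + 1))).
    { unfold B; rewrite <- pow_add; do 2 f_equal; lia. }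
    assert (H7 : 2 ^ (7 * M + 2) = N * 2 * 2 ^ (4 * M) * 2 ^ (2 * M + 1)).
    { replace (7 * M + 2)%nat with (M + (1 + (4 * M + (2 * M + 1))))%nat by lia.
      unfold N; rewrite (pow_add 2 M), (pow_add 2 1), (pow_add 2 (4 * M)), pow_1; ring. }
    assert (Hsm : 0 < 2 ^ (2 * M + 1)) by (apply pow_lt; lra).
    unfold tau; rewrite H16, HB'.
    rewrite H7 in Hgrowth.
    revert Hgrowth Hbig Hsm.
    generalize (2 ^ (M * M)), (2 ^ (2 * M + 1)), (2 ^ (4 * M)), (tm_const M), (INR (fact m)).
    intros X Y Z K F Hgrowth HX HY.
    assert (HXY : 0 < X * X * Y) by (repeat apply Rmult_lt_0_compat; assumption).
    apply Rmult_le_reg_r with (X * X * Y); [exact HXY |].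
    replace (N * (K * (2 * (F * (Z / (X * X))))) * (X * X * Y))
      with (K * F * (N * 2 * Z * Y)) by (field; lra).
    replace (/ (X * Y) * (X * X * Y)) with X by (field; lra).
    exact Hgrowth. }
  assert (HBN : B * N <= / 16).
  { unfold B, N; replace (S M * S M)%nat with (M + (M * M + M + 1))%nat by lia.
    rewrite pow_add, Rinv_mult.
    assert (0 < 2 ^ M) by (apply pow_lt; lra).
    replace (/ 2 ^ M * / 2 ^ (M * M + M + 1) * 2 ^ M) with (/ 2 ^ (M * M + M + 1))
      by (field; split; [apply pow_nonzero |]; lra).
    apply Rinv_le_contravar; [lra |].
    replace 16 with (2 ^ 4) by ring; apply Rle_pow; [lra | unfold M in *; nia]. }
  assert (Htau0 : 0 <= tau).
  { left; apply Rmult_lt_0_compat; [apply tm_const_pos |].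
    apply Rmult_lt_0_compat; [lra |]; apply Rmult_lt_0_compat.
    - apply INR_fact_lt_0.
    - apply pow_lt, Rdiv_lt_0_compat; nra. }
  assert (Htaue : tau < e).
  { unfold e; rewrite Hq; apply Rmult_lt_reg_r with ((N + 1) ^ 2); [nra |].
    replace (4 / (N + 1) ^ 2 * (N + 1) ^ 2) with 4 by (field; lra).
    assert (N * tau * N <= / 16) by nra; nra. }
  assert (Htau1 : tau <= 1) by nra.
  set (t := 1 - 2 / q).
  assert (Ht : 0 < t <= 1).
  { assert (0 < 2 / q < 1).
    { split; [apply Rdiv_lt_0_compat; lra |].
      apply Rmult_lt_reg_r with q; [lra |]; field_simplify; lra. }
    unfold t; lra. }
  assert (Htt : t * t = 1 - e * N).
  { unfold t, e; replace N with (q - 1) by lra; field; lra. }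
  assert (HeN : e * N < 1) by nra.
  (* Here [1 - e * N = t * t = ((N - 1) / q) ^ 2], and [N - 1] is at least [N / 2]. *)
  assert (Hrho : e / (1 - e * N) <= 16 / N ^ 2).
  { replace (e / (1 - e * N)) with (4 / (N - 1) ^ 2).
    - apply Rmult_le_reg_r with ((N - 1) ^ 2 * N ^ 2); [apply Rmult_lt_0_compat; nra |].
      field_simplify; [nra | lra | lra].
    - rewrite <- Htt; unfold t, e; rewrite Hq; field; lra. }
  assert (Hfan : fan e tau t t (2 ^ M)).
  { apply fan_thue_morse; auto.
    eapply Rle_trans; [apply thue_morse_log_step_le; auto |].
    unfold tau; apply Rmult_le_compat_l; [left; apply tm_const_pos |].
    apply Rmult_le_compat_l; [lra |].
    apply Rmult_le_compat_l; [apply pos_INR |].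
    change (2 ^ S m) with N.
    apply pow_incr; split; [apply div_nonneg; lra | exact Hrho]. }
  destruct (square_of_fan tau (2 ^ M) c) as (D & HD & Hlen & Harea); auto.
  { apply INR_le; rewrite HNnat; simpl; lra. }
  exists D; split; [exact HD | split; [exact Hlen |]].
  fold q n in Harea.
  (* As [q <= n], the left side is at most [q / 2 = (N + 1) / 2]. *)
  assert (Hcoef : 2 * (q ^ 2 / (4 * n)) <= N).
  { apply Rmult_le_reg_r with (4 * n); [lra |].
    field_simplify; [| lra]; nra. }
  apply range_le; [lra |].
  intros T1 T2 H1 H2.
  replace (area T1 - area T2) with ((area T1 - / n) - (area T2 - / n)) by ring.
  eapply Rle_trans; [apply Rabs_triang |]; rewrite Rabs_Ropp.
  pose proof (Harea T1 H1); pose proof (Harea T2 H2); nra.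
Qed.

Theorem theorem7p5 :
  exists (C : R) (n0 : nat), 0 < C /\
    forall n : nat, (n0 <= n)%nat -> Nat.Odd n ->
      exists D : list tri,
        dissection_unit_square D /\ length D = n /\
        range D <= 8 * INR n ^ 4 / (Rpower (INR n) (log2 (INR n)) * log2 (INR n))
                   * (1 + C * ln (INR n) / INR n).
Proof.
  destruct thue_morse_square as [m0 Hsq].
  exists 1, (2 ^ S m0 + 1)%nat; split; [lra |]; intros n Hn [h Hodd].
  assert (Hpow0 : (2 ^ S m0 <> 0)%nat) by (apply Nat.pow_nonzero; lia).
  destruct (Nat.log2_spec (n - 1) ltac:(lia)) as [Hlo Hhi].
  assert (Hm : (S m0 <= Nat.log2 (n - 1))%nat).
  { rewrite <- (Nat.log2_pow2 (S m0)) by lia; apply Nat.log2_le_mono; lia. }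
  destruct (Nat.log2 (n - 1)) as [| m]; [lia |].
  (* With [n = 2 * h + 1], taking [c = h - 2 ^ m] gives exactly [n] triangles. Maximality of the
     power of two yields [n <= 2 ^ S (S m)], which matches the exponent in the range bound. *)
  destruct (Hsq m (h - 2 ^ m)%nat ltac:(lia)) as (D & HD & Hlen & Hrange).
  rewrite Nat.pow_succ_r' in Hlo, Hlen.
  exists D; split; [now apply dissects_unit_square | split; [lia |]].
  eapply Rle_trans; [exact Hrange | apply target_bound_ge; split].
  - apply (le_INR 2); lia.
  - replace (2 ^ S (S m)) with (INR (2 ^ S (S m))) by (rewrite pow_INR; reflexivity).
    apply le_INR; lia.
Qed.
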